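(* Let $G = (V(G), E(G), \mathbf{s}, \mathbf{r})$ be a non-trivial directed graph. Every non-zero element of $I(G)$ is a vertex of $\Gamma(I(G))$, that is, $V(\Gamma(I(G))) = I(G)^\times$, where $I(G)^\times = I(G) \setminus \{0\}$.
   Context: A directed graph $G=(V(G),E(G),\mathbf{s},\mathbf{r})$ has a non-empty vertex set $V(G)$, an edge set $E(G)$ (loops and multiple edges allowed), and source and range maps $\mathbf{s},\mathbf{r}:E(G)\to V(G)$. It is trivial if it consists of one isolated vertex (one vertex, no edges); non-trivial otherwise. $\mathrm{Path}(G)$ is the set of all finite directed paths $p=e_1\cdots e_n$ (with $\mathbf{r}(e_i)=\mathbf{s}(e_{i+1})$, $\mathbf{s}(p)=\mathbf{s}(e_1)$, $\mathbf{r}(p)=\mathbf{r}(e_n)$), including each vertex $v$ as an empty path with $\mathbf{s}(v)=\mathbf{r}(v)=v$; $p^{-1}=e_n^{-1}\cdots e_1^{-1}$ and $v^{-1}=v$. The graph inverse semigroup $I(G)$ is the semigroup with zero generated by $V(G)\cup E(G)\cup\{e^{-1}:e\in E(G)\}$ subject to, for $u,v\in V(G)$, $e,f\in E(G)$: $uv=\delta_{u,v}u$; $\mathbf{s}(e)e=e\mathbf{r}(e)=e$; $\mathbf{r}(e)e^{-1}=e^{-1}\mathbf{s}(e)=e^{-1}$; $e^{-1}f=\delta_{e,f}\mathbf{r}(e)$. Every non-zero element is uniquely $pq^{-1}$ with $p,q\in\mathrm{Path}(G)$, $\mathbf{r}(p)=\mathbf{r}(q)$; $(pq^{-1})(rs^{-1})$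 equals $pts^{-1}$ if $r=qt$, $p(st)^{-1}$ if $q=rt$ (for a possibly empty path $t$), and $0$ otherwise. $I(G)$ is an inverse semigroup with idempotents $pp^{-1}$ ($p\in\mathrm{Path}(G)$) and $0$. For an inverse semigroup $T$ with zero, the natural partial order is $a\le b$ iff $a=eb$ for some idempotent $e$; $\omega(a,b)=\{c\in T:c\le a \text{ and } c\le b\}$. The zero-divisor graph $\Gamma(T)$ is the simple undirected graph with vertex set $V(\Gamma(T))=Z(T)^\times=\{a\in T\setminus\{0\}:\exists\,b\in T\setminus\{0\},\ \omega(a,b)=\{0\}\}$, where distinct vertices $a,b$ are adjacent iff $\omega(a,b)=\{0\}$. *)

(* Defs.v *)
From HB Require Import structures.
From mathcomp Require Import all_boot.
From mathcomp Require Import boolp classical_sets.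

Set Implicit Arguments.
Unset Strict Implicit.
Unset Printing Implicit Defensive.

Local Open Scope quotient_scope.
Local Open Scope classical_set_scope.
Local Open Scope group_scope.

Record digraph := Digraph {
  vertex : Type;
  edge : Type;
  source : edge -> vertex;
  range : edge -> vertex;
  vertex_inhabited : inhabited vertex
}.

Definition trivial_digraph (G : digraph) : Prop :=
  (exists v : vertex G, forall u : vertex G, u = v) /\ ~ inhabited (edge G).

HB.mixin Record Semigroup_hasZero T of Semigroup T := {
  zerog : T;
  mul0g : left_zero zerog (@mul T);
  mulg0 : right_zero zerog (@mul T)
}.

#[short(type="semigroup0Type")]
HB.structure Definition Semigroup0 := {T of Semigroup T & Semigroup_hasZero T}.

(* The next definitions only involve the product and the zero; they are meant *)
(* for inverse semigroups with zero.                                          *)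
Section ZeroDivisorGraph.
Variable T : semigroup0Type.
Implicit Types a b c e : T.

Definition idempotent_elt e : Prop := e * e = e.

Definition natural_le a b : Prop := exists e, idempotent_elt e /\ a = e * b.

Definition omega a b : set T := [set c | natural_le c a /\ natural_le c b].

Definition nonzero : set T := [set a | a <> zerog].

Definition zero_divisors : set T :=
  [set a | nonzero a /\ exists b, nonzero b /\ omega a b = [set zerog]].

End ZeroDivisorGraph.

Arguments nonzero : clear implicits.
Arguments zero_divisors : clear implicits.

Record simple_graph (T : Type) := SimpleGraph {
  sg_vertices : set T;
  sg_adj : T -> T -> Prop;
  sg_adj_vertices : forall a b, sg_adj a b -> sg_vertices a /\ sg_vertices b;
  sg_adj_sym : forall a b, sg_adj a b -> sg_adj b a;
  sg_adj_irrefl : forall a, ~ sg_adj a a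
}.

Section ZeroDivisorGraphGraph.
Variable T : semigroup0Type.
Implicit Types a b : T.

Definition zd_adj a b : Prop :=
  [/\ zero_divisors T a, zero_divisors T b, a <> b & omega a b = [set zerog]].

Fact zd_adj_vertices a b : zd_adj a b -> zero_divisors T a /\ zero_divisors T b.
Proof. by case. Qed.

Fact zd_adj_sym a b : zd_adj a b -> zd_adj b a.
Proof.
case=> za zb neq_ab ab0; split=> // [eq_ba|]; first exact: neq_ab.
by rewrite -ab0; apply/seteqP; split=> c [].
Qed.

Fact zd_adj_irrefl a : ~ zd_adj a a.
Proof. by case=> _ _ /(_ erefl). Qed.

Definition zero_divisor_graph : simple_graph T :=
  SimpleGraph zd_adj_vertices zd_adj_sym zd_adj_irrefl.

End ZeroDivisorGraphGraph.

(* I(G) is built from its presentation: formal products of the generators     *)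
(* (and of a formal zero), modulo the least congruence that makes the product *)
(* associative, the formal zero absorbing, and the defining relations hold.   *)
Inductive ig_term (G : digraph) : Type :=
| IGzero
| IGvertex of vertex G
| IGedge of edge G
| IGedgeV of edge G
| IGmul of ig_term G & ig_term G.

Arguments IGzero {G}.

Inductive ig_rel (G : digraph) : ig_term G -> ig_term G -> Prop :=
| ig_vv u : ig_rel (IGmul (IGvertex u) (IGvertex u)) (IGvertex u)
| ig_uv u v : u <> v -> ig_rel (IGmul (IGvertex u) (IGvertex v)) IGzero
| ig_se e : ig_rel (IGmul (IGvertex (source e)) (IGedge e)) (IGedge e)
| ig_er e : ig_rel (IGmul (IGedge e) (IGvertex (range e))) (IGedge e)
| ig_reV e : ig_rel (IGmul (IGvertex (range e)) (IGedgeV e)) (IGedgeV e)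
| ig_eVs e : ig_rel (IGmul (IGedgeV e) (IGvertex (source e))) (IGedgeV e)
| ig_eVe e : ig_rel (IGmul (IGedgeV e) (IGedge e)) (IGvertex (range e))
| ig_eVf e f : e <> f -> ig_rel (IGmul (IGedgeV e) (IGedge f)) IGzero.

Inductive ig_cong (G : digraph) : ig_term G -> ig_term G -> Prop :=
| ig_cong_rel x y : ig_rel x y -> ig_cong x y
| ig_cong_assoc x y z :
    ig_cong (IGmul x (IGmul y z)) (IGmul (IGmul x y) z)
| ig_cong_0l x : ig_cong (IGmul IGzero x) IGzero
| ig_cong_0r x : ig_cong (IGmul x IGzero) IGzero
| ig_cong_mul x x' y y' :
    ig_cong x x' -> ig_cong y y' -> ig_cong (IGmul x y) (IGmul x' y')
| ig_cong_refl x : ig_cong x x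
| ig_cong_sym x y : ig_cong x y -> ig_cong y x
| ig_cong_trans x y z : ig_cong x y -> ig_cong y z -> ig_cong x z.

HB.instance Definition _ (G : digraph) := gen_eqMixin (ig_term G).
HB.instance Definition _ (G : digraph) := gen_choiceMixin (ig_term G).

Section GraphInverseSemigroup.
Variable G : digraph.

Definition ig_equiv (x y : ig_term G) : bool := `[< ig_cong x y >].

Fact ig_equiv_refl : reflexive ig_equiv.
Proof. by move=> x; apply/asboolP; exact: ig_cong_refl. Qed.

Fact ig_equiv_sym : symmetric ig_equiv.
Proof. by move=> x y; apply/asboolP/asboolP; exact: ig_cong_sym. Qed.

Fact ig_equiv_trans : transitive ig_equiv.
Proof.
by move=> y x z /asboolP xy /asboolP yz; apply/asboolP; exact: ig_cong_trans yz.
Qed.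

Canonical ig_equiv_rel :=
  EquivRel ig_equiv ig_equiv_refl ig_equiv_sym ig_equiv_trans.

Definition graph_inverse_semigroup : Type := {eq_quot ig_equiv}.

HB.instance Definition _ := Choice.on graph_inverse_semigroup.

Definition ig_class (x : ig_term G) : graph_inverse_semigroup :=
  \pi_({eq_quot ig_equiv}) x.

Definition ig_repr (a : graph_inverse_semigroup) : ig_term G :=
  repr (a : {eq_quot ig_equiv}).

Definition ig_mul (a b : graph_inverse_semigroup) : graph_inverse_semigroup :=
  ig_class (IGmul (ig_repr a) (ig_repr b)).

Lemma ig_reprK a : ig_class (ig_repr a) = a.
Proof. exact: reprK. Qed.

Lemma ig_classP x y : ig_class x = ig_class y <-> ig_cong x y.
Proof.
split=> [/(@eqmodP _ ig_equiv_rel)/asboolP //|xy].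
by apply/(@eqmodP _ ig_equiv_rel)/asboolP.
Qed.

Lemma ig_class_mul x y : ig_mul (ig_class x) (ig_class y) = ig_class (IGmul x y).
Proof. by apply/ig_classP/ig_cong_mul; apply/ig_classP; rewrite ig_reprK. Qed.

Fact ig_mulA : associative ig_mul.
Proof.
move=> a b c; rewrite -(ig_reprK a) -(ig_reprK b) -(ig_reprK c) !ig_class_mul.
exact/ig_classP/ig_cong_assoc.
Qed.

Fact ig_mul0g : left_zero (ig_class IGzero) ig_mul.
Proof.
by move=> a; rewrite -(ig_reprK a) ig_class_mul; apply/ig_classP/ig_cong_0l.
Qed.

Fact ig_mulg0 : right_zero (ig_class IGzero) ig_mul.
Proof.
by move=> a; rewrite -(ig_reprK a) ig_class_mul; apply/ig_classP/ig_cong_0r.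
Qed.

HB.instance Definition _ := isSemigroup.Build graph_inverse_semigroup ig_mulA.
HB.instance Definition _ :=
  Semigroup_hasZero.Build graph_inverse_semigroup ig_mul0g ig_mulg0.

End GraphInverseSemigroup.

(* Main.v *)
Require Import Defs.
From mathcomp Require Import all_boot.
From mathcomp Require Import all_algebra.
From mathcomp Require Import boolp classical_sets.

(* Counting each edge e as +1 and each e^-1 as -1 gives a degree on the       *)
(* non-zero elements of I(G) that is additive on non-zero products.  Non-zero *)
(* idempotents have degree 0, so a non-zero element has the same degree as    *)
(* everything above it.  If G has an edge e, the degrees 0 and 1 of s(e) and  *)
(* e differ, so every non-zero a meets one of s(e), e only in 0.  If G has no *)
(* edge, the non-zero elements are the vertices, and two distinct vertices    *)
(* meet only in 0 because their product is 0.                                 *)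

Set Implicit Arguments.
Unset Strict Implicit.
Unset Printing Implicit Defensive.

Import GRing.Theory.
Local Open Scope classical_set_scope.
Local Open Scope group_scope.

Lemma omega_zeroP (T : semigroup0Type) (a b : T) :
  (forall c, natural_le c a -> natural_le c b -> c = zerog) ->
  omega a b = [set zerog].
Proof.
move=> ab0; apply/seteqP; split=> c /= => [[]|->]; first exact: ab0.
by split; exists zerog; rewrite /idempotent_elt !mul0g.
Qed.

Section GraphInverseSemigroupTheory.
Variable G : digraph.
Implicit Types (x y : ig_term G) (a b c : graph_inverse_semigroup G).

Lemma ig_classM x y : ig_class (IGmul x y) = ig_class x * ig_class y.
Proof. by symmetry; exact: ig_class_mul. Qed.

(* I(G) acts on Path(G) by left multiplication (partially defined); a path is *)
(* encoded by its list of edges together with its range, and [path_act x s t] *)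
(* says that [x] maps [s] to [t].                                             *)
Definition path_code : Type := (seq (edge G) * vertex G)%type.

(** The edges of a code need not compose: the action reads only the head of the list, or the vertex
    when the list is empty. *)
Definition path_src (s : path_code) : vertex G :=
  if s.1 is e :: _ then source e else s.2.

Fixpoint path_act x (s t : path_code) : Prop :=
  match x with
  | IGzero => False
  | IGvertex v => path_src s = v /\ t = s
  | IGedge e => path_src s = Defs.range e /\ t = (e :: s.1, s.2)
  | IGedgeV e => path_src t = Defs.range e /\ s = (e :: t.1, t.2)
  | IGmul x y => exists2 r, path_act y s r & path_act x r t
  end.

Lemma path_act_rel x y s t : ig_rel x y -> path_act x s t <-> path_act y s t.
Proof.
case=> {x y}.
- by move=> u /=; split=> [[r [? ->] []]|[? ->]] //; exists s.
- by move=> u v uv /=; split=> // -[r [sv ->] [su _]]; case: uv; rewrite -su.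
- move=> e /=; split=> [[r [? ->] [_ ->]]|[? ->]] //.
  by exists (e :: s.1, s.2).
- by move=> e /=; split=> [[r [? ->] []]|[? ->]] //; exists s.
- by move=> e /=; split=> [[r [? ->] [_ ->]]|[? ->]] //; exists t.
- move=> e /=; split=> [[r [_ ->] []]|[? ->]] //.
  by exists (e :: t.1, t.2).
- move=> e /=; split=> [[[l w] [? ->] [? [? ?]]]|[? ->]].
    by split=> //; rewrite [t]surjective_pairing [s]surjective_pairing; congr pair.
  by exists (e :: s.1, s.2).
- by move=> e f ef /=; split=> // -[r [_ ->] [_ [fe _]]]; case: ef.
Qed.

(** Products act by composing relations, which is associative with the empty relation absorbing;
    only the defining relations need checking. *)
Lemma path_act_cong x y : ig_cong x y ->
  forall s t, path_act x s t <-> path_act y s t.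
Proof.
elim=> {x y}.
- by move=> x y xy s t; exact: path_act_rel.
- move=> x y z s t /=; split.
    by case=> r [q zq yr] xt; exists q => //; exists r.
  by case=> q zq [r yr xt]; exists r => //; exists q.
- by move=> x s t; split=> // -[].
- by move=> x s t; split=> // -[].
- move=> x x' y y' _ xx' _ yy' s t /=.
  by split=> -[r /yy' ? /xx' ?]; exists r.
- by [].
- by move=> x y _ xy s t; split=> /xy.
- by move=> x y z _ xy _ yz s t; split=> [/xy/yz|/yz/xy].
Qed.

(** This is what the action is for: [v] fixes the empty path at [v], while zero relates nothing. *)
Lemma ig_vertex_neq0 (v : vertex G) : ig_class (IGvertex v) <> zerog.
Proof.
by move/ig_classP/path_act_cong/(_ ([::], v) ([::], v)) => [] /(_ (conj erefl erefl)).
Qed.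

Lemma ig_edge_neq0 (e : edge G) : ig_class (IGedge e) <> zerog.
Proof.
(* If [e] were zero, so would be the vertex that the product of its inverse with [e] equals. *)
move=> e0; apply: (@ig_vertex_neq0 (Defs.range e)).
rewrite -(proj2 (ig_classP _ _) (ig_cong_rel (ig_eVe e))).
by rewrite ig_classM e0 mulg0.
Qed.

Fixpoint term_deg x : int :=
  match x with
  | IGzero | IGvertex _ => 0%R
  | IGedge _ => 1%R
  | IGedgeV _ => (-1)%R
  | IGmul x y => (term_deg x + term_deg y)%R
  end.

(** The degree respects the defining relations and associativity, but not absorption:
    [IGmul IGzero x] keeps the degree of [x]. The first alternative covers this, and it propagates
    because zero absorbs. *)
Lemma term_deg_cong x y : ig_cong x y ->
  ig_cong x IGzero /\ ig_cong y IGzero \/ term_deg x = term_deg y.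
Proof.
have mul0 u v : ig_cong u IGzero -> ig_cong (IGmul u v) (@IGzero G).
  move=> u0; apply: ig_cong_trans (ig_cong_0l v).
  exact: ig_cong_mul u0 (ig_cong_refl v).
have mulr0 u v : ig_cong v IGzero -> ig_cong (IGmul u v) (@IGzero G).
  move=> v0; apply: ig_cong_trans (ig_cong_0r u).
  exact: ig_cong_mul (ig_cong_refl u) v0.
elim=> {x y}.
- by move=> x y []; right; rewrite /= ?addr0 ?add0r ?addNr.
- by move=> x y z; right; rewrite /= addrA.
- by move=> x; left; split; [exact: ig_cong_0l | exact: ig_cong_refl].
- by move=> x; left; split; [exact: ig_cong_0r | exact: ig_cong_refl].
- move=> x x' y y' _ [[x0 x'0]|dx] _ [[y0 y'0]|dy]; try by left; auto.
  by right; rewrite /= dx dy.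
- by right.
- by move=> x y _ [[]|->]; [left | right].
- move=> x y z xy [[x0 y0]|dxy] yz [[y0' z0]|dyz].
  + by left.
  + by left; split=> //; apply: ig_cong_trans (ig_cong_sym yz) y0.
  + by left; split=> //; apply: ig_cong_trans xy y0'.
  + by right; rewrite dxy.
Qed.

(* Only meaningful for a <> 0: the degree of 0 depends on the chosen representative. *)
Definition ig_deg a : int := term_deg (ig_repr a).

Lemma ig_deg_class x : ig_class x <> zerog -> ig_deg (ig_class x) = term_deg x.
Proof.
move=> x0; have /ig_classP/term_deg_cong := ig_reprK (ig_class x).
by case=> // -[_ /ig_classP].
Qed.

Lemma ig_degM a b : a * b <> zerog -> ig_deg (a * b) = (ig_deg a + ig_deg b)%R.
(* By conversion, [a * b] is the class of the product of the two representatives. *)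
Proof. exact: ig_deg_class. Qed.

Lemma ig_deg_idempotent a : idempotent_elt a -> a <> zerog -> ig_deg a = 0%R.
Proof.
move=> aa a0; have := @ig_degM a a; rewrite aa => /(_ a0).
by move/eqP; rewrite -[X in X == _]addr0 (inj_eq (addrI _)) => /eqP.
Qed.

Lemma ig_deg_le a b : natural_le a b -> a <> zerog -> ig_deg a = ig_deg b.
Proof.
case=> e [ee ->] eb0; rewrite ig_degM // ig_deg_idempotent ?add0r // => e0.
by apply: eb0; rewrite e0 mul0g.
Qed.

Lemma ig_deg_omega a b : ig_deg a <> ig_deg b -> omega a b = [set zerog].
Proof.
move=> dab; apply: omega_zeroP => c ca cb; apply: contrapT => c0.
by apply: dab; rewrite -(ig_deg_le ca c0) -(ig_deg_le cb c0).
Qed.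

Lemma ig_vertexM (u v : vertex G) :
  ig_class (IGvertex u) * ig_class (IGvertex v) =
  if `[< u = v >] then ig_class (IGvertex u) else zerog.
Proof.
rewrite -ig_classM; case: asboolP => uv; apply/ig_classP/ig_cong_rel.
  by rewrite -uv; exact: ig_vv.
exact: ig_uv.
Qed.

Lemma omega_vertices (u v : vertex G) : u <> v ->
  omega (ig_class (IGvertex u)) (ig_class (IGvertex v)) = [set zerog].
Proof.
move=> uv; apply: omega_zeroP => c [e [_ cu]] [f [_ cv]].
(* Below [v], [c] is fixed by right multiplication by [v]; below [u], that multiplication kills
   it. *)
have cvE : c * ig_class (IGvertex v) = c.
  by rewrite cv -mulgA ig_vertexM asboolT.
by rewrite -cvE cu -mulgA ig_vertexM asboolF // mulg0.
Qed.

(** Vertices together with zero are closed under products. *)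
Lemma ig_edgeless a : ~ inhabited (edge G) -> a <> zerog ->
  exists u, a = ig_class (IGvertex u).
Proof.
move=> noE; rewrite -(ig_reprK a); elim: (ig_repr a) => {a} //.
- by move=> v _; exists v.
- by move=> e; case: noE.
- by move=> e; case: noE.
- move=> x IHx y IHy; rewrite ig_classM => xy0.
  have [|u xu] := IHx; first by move=> x0; apply: xy0; rewrite x0 mul0g.
  have [|v yv] := IHy; first by move=> y0; apply: xy0; rewrite y0 mulg0.
  by move: xy0; rewrite xu yv ig_vertexM; case: ifP => // _ _; exists u.
Qed.

End GraphInverseSemigroupTheory.

Theorem proposition5p5 (G : digraph) (nontrivial_G : ~ trivial_digraph G) :
  sg_vertices (zero_divisor_graph (graph_inverse_semigroup G)) =
  nonzero (graph_inverse_semigroup G).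
Proof.
apply/seteqP; split=> a /= => [[]//|a0]; split=> //.
have [[e]|noE] := EM (inhabited (edge G)).
  have [da|da] := eqVneq (ig_deg a) 0%R.
    exists (ig_class (IGedge e)); split; first exact: ig_edge_neq0.
    by apply: ig_deg_omega; rewrite da ig_deg_class //; exact: ig_edge_neq0.
  exists (ig_class (IGvertex (source e))); split; first exact: ig_vertex_neq0.
  apply: ig_deg_omega; rewrite ig_deg_class; last exact: ig_vertex_neq0.
  exact/eqP.
have [u ->] := ig_edgeless noE a0.
(* Non-triviality enters here: an edgeless graph with [u] as its only vertex is trivial. *)
have [v vu] : exists v, v <> u.
  by apply/existsNP => allu; apply: nontrivial_G; split=> //; exists u.
exists (ig_class (IGvertex v)); split; first exact: ig_vertex_neq0.
by apply: omega_vertices => uv; apply: vu.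
Qed.
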